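(* Let $k\geq 1$ and let $P_{2k+1}$ be the path with vertices $u_1,u_2,\dots,u_{2k+1}$ (in this order). Let $H_1,H_2,\dots,H_{2k+1}$ be graphs, each with exactly $n$ vertices. Then the graph $P_{2k+1}[H_1,H_2,\dots,H_{2k+1}]$ is (i) hamiltonian if and only if $\pi(H_1)\geq 1$, $\pi(H_{2k+1})\geq 1$ and $\sum_{i=0}^{k}\pi(H_{2i+1})\geq n$; (ii) traceable if and only if $\sum_{i=0}^{k}\pi(H_{2i+1})\geq n-1$; (iii) hamiltonian connected if and only if $\pi(H_1)\geq 2$, $\pi(H_{2k+1})\geq 2$ and $\sum_{i=0}^{k}\pi(H_{2i+1})\geq n+1$.
   Context: Generalized lexicographic product: for a graph $G$ with $V(G)=\{u_1,\dots,u_m\}$ and graphs $H_1,\dots,H_m$ each on $n$ vertices, $G[H_1,\dots,H_m]$ is obtained from $G$ by replacing each vertex $u_i$ with a copy of $H_i$ (keeping the edges of $H_i$) and adding all edges between the copies of $H_i$ and $H_j$ whenever $u_iu_j\in E(G)$. For a graph $H$, $\pi(H)$ denotes the maximum number of edges of a spanning linear forest of $H$ (a forest all of whose components are paths). A graph is traceable if it has a hamiltonian path, and hamiltonian connected if every two vertices are joined by a hamiltonian path. *)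

(* Defs.v *)
From mathcomp Require Import all_boot.

Set Implicit Arguments.
Unset Strict Implicit.
Unset Printing Implicit Defensive.

Record sgraph := SGraph {
  svertex :> finType;
  sedge : rel svertex;
  sedge_sym : symmetric sedge;
  sedge_irr : irreflexive sedge }.

Lemma path_rel_sym m : symmetric (fun i j : 'I_m => (i.+1 == j) || (j.+1 == i)).
Proof. by move=> i j; rewrite orbC. Qed.

Lemma path_rel_irr m :
  irreflexive (fun i j : 'I_m => (i.+1 == j) || (j.+1 == i)).
Proof. by move=> i /=; rewrite orbb eqn_leq ltnn. Qed.

(* The vertex u_(i+1) of the path u_1, ..., u_m is the ordinal i : 'I_m. *)
Definition path_graph (m : nat) : sgraph :=
  SGraph (@path_rel_sym m) (@path_rel_irr m).

Section LexProduct.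
Variables (G : sgraph) (H : G -> sgraph).

(* tagged_as x y is the second component of y, transported to the fibre of x; *)
(* it is meaningful only when tag x == tag y.                                 *)
Definition lex_rel (x y : {u : G & H u}) : bool :=
  sedge (tag x) (tag y)
  || ((tag x == tag y) && sedge (tagged x) (tagged_as x y)).

Lemma lex_rel_sym : symmetric lex_rel.
Proof.
move=> [u a] [v b]; rewrite /lex_rel /= sedge_sym; congr (_ || _).
have [e|//] := eqVneq u v.
by case: v / e b => b; rewrite !tagged_asE sedge_sym.
Qed.

Lemma lex_rel_irr : irreflexive lex_rel.
Proof. by move=> [u a]; rewrite /lex_rel /= sedge_irr tagged_asE sedge_irr andbF. Qed.

Definition lex_product : sgraph := SGraph lex_rel_sym lex_rel_irr.
End LexProduct.

Section Hamiltonicity.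
Variable G : sgraph.

(* The sequence of vertices x :: p is a hamiltonian path starting at x. *)
Definition ham_path (x : G) (p : seq G) : Prop :=
  [/\ path (@sedge G) x p, uniq (x :: p) & forall z, z \in x :: p].

Definition hamiltonian : Prop :=
  exists c : seq G,
    [/\ 3 <= size c, ucycle (@sedge G) c & forall z, z \in c].

Definition traceable : Prop := exists x p, ham_path x p.

Definition hamiltonian_connected : Prop :=
  forall x y : G, x != y -> exists2 p, ham_path x p & last x p = y.
End Hamiltonicity.

Section LinearForest.
Variable G : sgraph.

(* Bounding the length of the cycles by #|G| loses nothing, since ucycleb    *)
(* requires the vertices to be pairwise distinct.                            *)
Definition is_forest : bool :=
  [forall m : 'I_#|G|.+1, forall c : m.-tuple G,
     (3 <= m) ==> ~~ ucycleb (@sedge G) c].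

Definition component (x : G) : {set G} := [set y | connect (@sedge G) x y].

(* The subgraph of G induced on S is isomorphic to a path graph. *)
Definition induces_path (S : {set G}) : bool :=
  [exists f : {ffun 'I_#|S| -> G},
     [&& injectiveb f, [set f i | i : 'I_#|S|] == S
       & [forall i, forall j,
            sedge (f i) (f j) == @sedge (path_graph #|S|) i j]]].

Definition is_linear_forest : bool :=
  is_forest && [forall x, induces_path (component x)].
End LinearForest.

Section SpanningSubgraph.
Variable G : sgraph.

Definition edge_set : {set {set G}} :=
  [set [set p.1; p.2] | p : G * G & sedge p.1 p.2].

Variable F : {set {set G}}.

Definition spanning_rel (x y : G) : bool := (x != y) && ([set x; y] \in F).

Lemma spanning_rel_sym : symmetric spanning_rel.
Proof. by move=> x y; rewrite /spanning_rel eq_sym setUC. Qed.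

Lemma spanning_rel_irr : irreflexive spanning_rel.
Proof. by move=> x; rewrite /spanning_rel eqxx. Qed.

Definition spanning_subgraph : sgraph :=
  SGraph spanning_rel_sym spanning_rel_irr.
End SpanningSubgraph.

(* The invariant written pi(G) in the literature. *)
Definition linear_forest_number (G : sgraph) : nat :=
  \max_(F : {set {set G}} | (F \subset edge_set G)
                            && is_linear_forest (spanning_subgraph F)) #|F|.

(* Main.v *)
(** A graph on [n] vertices has a spanning linear forest with at least [e] edges
if and only if its vertices can be listed so that at least [e] consecutive pairs
are edges; a listing with [e] such pairs can be cut into [n - e] paths.

Necessity: restrict a hamiltonian path of the product to the layers of even index
(numbered from 0). Each of its edges either meets one of the [k * n] vertices of
the odd layers or lies inside an even layer, and double counting bounds the number
of edges of the second kind from below by [n - 1] plus the number of ends in odd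
layers. If the first layer contained too few edges of the path, then the edges
from it to the second layer would use up all the degrees there, and the path could
not reach the third layer; the last layer is symmetric.

Sufficiency: cut the listings of the even layers into paths, [kn], [kn + 1] or
[kn - 1] in all according to the parity of the layers of the two ends, and the odd
layers into single vertices. Contracting the paths, it remains to walk on the path
of layers visiting each layer a prescribed number of times. The number of steps
between two consecutive layers is then forced, and such a walk exists as soon as
all these numbers are positive (an Eulerian trail of a multigraph on a path). For
given ends [x] and [y], a listing is first rearranged to begin at [x] or to end
at [y], which costs at most one edge for each of them. A hamiltonian cycle is
obtained as a hamiltonian path from the first layer to the second. *)

Require Import Defs.
From mathcomp Require Import all_boot.
From mathcomp Require Import zify.

Set Implicit Arguments.
Unset Strict Implicit.
Unset Printing Implicit Defensive.

(** * Sums over consecutive pairs *)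

Section PairSum.
Variable T : Type.
Implicit Types (f g : T -> T -> nat) (s : seq T) (x y : T).

(** Weights are natural numbers so that edges (boolean relations, by coercion), degrees and
    crossings of a cut can all be summed along one sequence. *)
Fixpoint pair_sum f s : nat :=
  if s is x :: s' then (if s' is y :: _ then f x y else 0) + pair_sum f s'
  else 0.

Lemma pair_sum_cat f x s1 y s2 :
  pair_sum f ((x :: s1) ++ y :: s2) =
  pair_sum f (x :: s1) + f (last x s1) y + pair_sum f (y :: s2).
Proof. by elim: s1 x => [|z s1 IH] x /=; [lia | move: (IH z) => /=; lia]. Qed.

Lemma leq_pair_sum_cat f s1 s2 :
  pair_sum f s1 + pair_sum f s2 <= pair_sum f (s1 ++ s2).
Proof.
case: s1 s2 => [|x s1] [|y s2]; rewrite ?cats0 ?addn0 //.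
by rewrite pair_sum_cat; lia.
Qed.

Lemma pair_sum_rev f s : (forall x y, f x y = f y x) ->
  pair_sum f (rev s) = pair_sum f s.
Proof.
move=> fC; elim: s => [|x [|y s] IH] //.
rewrite rev_cons -cats1.
case E: (rev (y :: s)) => [|z r]; first by move/(congr1 size): E; rewrite size_rev.
have -> : pair_sum f (x :: y :: s) = f x y + pair_sum f (y :: s) by [].
have lzr : last z r = y by have := congr1 (last z) E; rewrite rev_cons last_rcons.
by rewrite pair_sum_cat -IH E lzr (fC x) (_ : pair_sum f [:: x] = 0) // addn0 addnC.
Qed.

Lemma pair_sumD f g s :
  pair_sum (fun x y => f x y + g x y) s = pair_sum f s + pair_sum g s.
Proof. by elim: s => [|x [|y s] IH] //=; move: IH => /=; lia. Qed.

Lemma pair_sum_le (e : rel T) f g x s :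
  (forall y z, e y z -> f y z <= g y z) -> path e x s ->
  pair_sum f (x :: s) <= pair_sum g (x :: s).
Proof.
move=> fg; elim: s x => [|y s IH] x //= /andP[exy pys].
by apply: leq_add; [exact: fg | exact: IH].
Qed.

(** Every entry lies in two consecutive pairs, except that each end of the sequence misses one. *)
Lemma pair_sum_ends (a : pred T) x s :
  pair_sum (fun y z => a y + a z) (x :: s) + a x + a (last x s) =
  (count a (x :: s)).*2.
Proof. by elim: s x => [|y s IH] x /=; [lia | move: (IH y) => /=; lia]. Qed.

Lemma pair_sum_bigsum (I : finType) (f : I -> T -> T -> nat) s :
  pair_sum (fun x y => \sum_i f i x y) s = \sum_i pair_sum (f i) s.
Proof.
elim: s => [|x [|y s] IH]; [by rewrite big1 | by rewrite big1 |].
rewrite -[LHS]/(\sum_i f i x y + pair_sum _ (y :: s)) IH -big_split.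
exact: eq_bigr.
Qed.

Lemma pair_sum1 x s : pair_sum (fun _ _ => 1) (x :: s) = size s.
Proof. by elim: s x => [|y s IH] x //; have := IH y => /= ->; lia. Qed.

(** An entry is glued to the piece that follows when the pair is an edge and the quota [e] is not
    exhausted, and cut off otherwise: exactly [e] pairs get glued. *)
Lemma cut_into_paths (r : rel T) (e : nat) (s : seq T) :
  0 < size s -> e <= pair_sum r s ->
  exists Q : seq (seq T),
    [/\ flatten Q = s, size Q + e = size s
      & all (fun q => if q is x :: p then path r x p else false) Q].
Proof.
elim: s e => // x [|y s] IH e _.
  rewrite /= leqn0 => /eqP->; by exists [:: [:: x]].
have -> : pair_sum r (x :: y :: s) = r x y + pair_sum r (y :: s) by [].
case rxy: (r x y); case: e => [|e] le_e.
- have [//|Q [fQ sQ aQ]] := IH 0 isT; exists ([:: x] :: Q).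
  by rewrite /= fQ; split=> //; move: sQ => /=; lia.
- have [|Q [fQ sQ aQ]] := IH e isT; first by lia.
  case: Q fQ sQ aQ => [|[|z q] Q] //= [] -> fQ sQ /andP[pq aQ].
  exists ((x :: y :: q) :: Q) => /=; split; [by rewrite -fQ | by lia |].
  by rewrite rxy pq.
- have [//|Q [fQ sQ aQ]] := IH 0 isT; exists ([:: x] :: Q).
  by rewrite /= fQ; split=> //; move: sQ => /=; lia.
- have [|Q [fQ sQ aQ]] := IH e.+1 isT; first by lia.
  by exists ([:: x] :: Q); rewrite /= fQ; split => //; move: sQ => /=; lia.
Qed.
End PairSum.

(** * Moving prescribed entries to the ends of a listing *)

Section Rearrange.
Variables (T : eqType) (r : rel T).
Hypothesis r_sym : symmetric r.

(** Rotating the listing at [x] breaks only the pair in front of [x]. *)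
Lemma rearrange_head (s : seq T) x : x \in s ->
  exists s', perm_eq (x :: s') s /\ pair_sum r s <= (pair_sum r (x :: s')).+1.
Proof.
case/splitPr => s1 s2; exists (s2 ++ s1); split.
  by rewrite -cat_cons perm_catC.
case: s1 => [|z s1]; first by rewrite cats0 /=; lia.
rewrite pair_sum_cat; have := leq_pair_sum_cat r (x :: s2) (z :: s1).
by rewrite cat_cons; case: (r _ x); lia.
Qed.

Lemma rearrange_last (s : seq T) y : y \in s ->
  exists s', perm_eq (rcons s' y) s /\ pair_sum r s <= (pair_sum r (rcons s' y)).+1.
Proof.
move/rearrange_head=> [s' [ps le]]; exists (rev s'); rewrite -rev_cons perm_rev.
by rewrite pair_sum_rev // => u v; rewrite r_sym.
Qed.

(* [A x B y C] is rearranged into [x A^r C B y], which breaks only the pairs  *)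
(* following [x] and [y].                                                     *)
Lemma rearrange_both (s : seq T) x y : x \in s -> y \in s -> x != y ->
  exists s', perm_eq (x :: rcons s' y) s
             /\ pair_sum r s <= (pair_sum r (x :: rcons s' y)).+2.
Proof.
have rC u v : nat_of_bool (r u v) = r v u by rewrite r_sym.
move=> xs ys nxy.
have main A B C : exists s', perm_eq (x :: rcons s' y) (A ++ x :: B ++ y :: C)
    /\ pair_sum r (A ++ x :: B ++ y :: C) <= (pair_sum r (x :: rcons s' y)).+2.
  exists (rev A ++ C ++ B); split.
    apply/permP => a; rewrite -cats1 /= !(count_cat, count_rev) /= count_cat /=.
    by lia.
  have -> : x :: rcons (rev A ++ C ++ B) y = rev (rcons A x) ++ C ++ rcons B y.
    by rewrite rev_rcons -!cats1 /= -!catA.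
  have h1 := leq_pair_sum_cat r (rev (rcons A x)) (C ++ rcons B y).
  have h2 := leq_pair_sum_cat r C (rcons B y).
  have h3 := pair_sum_rev (rcons A x) rC.
  suff : pair_sum r (A ++ x :: B ++ y :: C) <=
     (pair_sum r (rcons A x) + pair_sum r (rcons B y) + pair_sum r C).+2 by lia.
  rewrite -cat_rcons -cat_rcons.
  have cut u v : pair_sum r (u ++ v) <= (pair_sum r u + pair_sum r v).+1.
    case: u v => [|a u] [|b v]; rewrite ?cats0 ?cat0s; try by lia.
    by rewrite pair_sum_cat; case: (r _ b); lia.
  by have := cut (rcons A x) (rcons B y ++ C); have := cut (rcons B y) C; lia.
case/splitPr: xs ys => A B; rewrite mem_cat inE => /or3P[|/eqP eyx|].
(* If [y] comes before [x], [main] is applied to the reversed listing. *)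
- case/splitPr => C A'; rewrite -catA cat_cons.
  have [s' [ps le]] := main (rev B) (rev A') (rev C).
  have E : rev B ++ x :: rev A' ++ y :: rev C = rev (C ++ y :: A' ++ x :: B).
    by rewrite !(rev_cat, rev_cons) -!cats1 -!catA.
  by exists s'; move: ps le; rewrite E perm_sym perm_rev perm_sym pair_sum_rev.
- by rewrite eyx eqxx in nxy.
- by case/splitPr => B' C; apply: main.
Qed.
End Rearrange.

(** * Walks on a path with prescribed numbers of steps *)

(** The adjacency of [path_graph] on bare numbers: it serves both for layers and for positions in a
    listing, and on ordinals it is convertible to [sedge]. *)
Definition adjn (i j : nat) := (i.+1 == j) || (j.+1 == i).

(** A detour [m], [m.+1], [m] inserted at a visit to [m] adds one visit to each of the two and keeps
    the ends of the walk. *)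
Lemma insert_bounces m b s p : m \in s :: p -> path adjn s p ->
  exists p', [/\ path adjn s p', last s p' = last s p
    & forall j, count_mem j (s :: p') =
        count_mem j (s :: p) + b * (m == j) + b * (m.+1 == j)].
Proof.
move=> msp psp; elim: b => [|b [p' [pp lp cp]]].
  by exists p; split=> // j; lia.
have : m \in s :: p'.
  by rewrite -has_pred1 has_count cp ltn_addr // ltn_addr // -has_count has_pred1.
move=> mp'; case/splitPl: mp' pp lp cp => p1 p2 last_m pp lp cp.
exists (p1 ++ [:: m.+1, m & p2]); split.
- move: pp; rewrite !cat_path /= last_m => /andP[-> ->].
  by rewrite /adjn !eqxx orbT.
- by rewrite -lp !last_cat /= last_m.
- by move=> j; move: (cp j); rewrite /= !count_cat /=; lia.
Qed.

(* [w j] is the number of steps of the walk between [j] and [j.+1]. *)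
Lemma euler_walk m (w : nat -> nat) (s t : nat) : s <= m -> t <= m ->
  (forall j, j < m -> 0 < w j) ->
  (forall j, j < m -> odd (w j) = (s <= j) (+) (t <= j)) ->
  exists p, [/\ path adjn s p, last s p = t
    & forall j, (count_mem j (s :: p)).*2 =
        (if 0 < j <= m then w j.-1 else 0) + (if j < m then w j else 0)
          + (s == j) + (t == j)].
Proof.
elim: m s t => [|m IH] s t les let_ w_gt0 w_odd.
  exists [::]; split=> //=; first by lia.
  by move=> j; case: (0 < j <= 0) / andP; lia.
(* The part beyond [m] is removed: an end at [m.+1] is pulled back to [m]. *)
have [||j ltj|j ltj|p [pp lp cp]] := IH (minn s m) (minn t m).
- exact: geq_minr.
- exact: geq_minr.
- by apply: w_gt0; lia.
- rewrite w_odd; last by lia.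
  by congr addb; lia.
have mp : m \in minn s m :: p.
  rewrite -has_pred1 has_count; have := cp m.
  case: (m =P 0) => [m0|m0]; first by subst m; lia.
  by have := w_gt0 m.-1; case: ifP; lia.
have := w_odd m (ltnSn m); have := w_gt0 m (ltnSn m) => wm_gt0 wm_odd.
(* Apart from the single steps due to ends at [m.+1], the crossings pair up into [b] detours.
   Positivity of [w m] matters when both ends are [m.+1], as parity alone would allow no
   crossing. *)
pose b := (w m - (s == m.+1) - (t == m.+1))./2.
have wmE : w m = b.*2 + (s == m.+1) + (t == m.+1) by rewrite /b; lia.
have [p' [pp' lp' cp']] := insert_bounces b mp pp.
(* A last step leads to [t] if it is [m.+1]; the first step from [s] is added at the end of the
   proof. *)
pose q := p' ++ (if t == m.+1 then [:: m.+1] else [::]).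
have pq : path adjn (minn s m) q.
  rewrite /q cat_path pp' lp' lp; case: eqP => //= ->.
  by rewrite andbT /adjn; lia.
have lq : last (minn s m) q = t.
  by rewrite /q last_cat lp' lp; case: eqP => //= tm; lia.
have cq j : count_mem j (minn s m :: q) =
    count_mem j (minn s m :: p') + ((t == m.+1) && (t == j)).
  rewrite /q -cat_cons count_cat; congr (_ + _).
  by case: eqP => //= ->; rewrite addn0.
clearbody b.
have fin j : (count_mem j (minn s m :: q)).*2 + ((s == m.+1) && (s == j)).*2 =
   (if 0 < j <= m.+1 then w j.-1 else 0) + (if j < m.+1 then w j else 0)
          + (s == j) + (t == j).
  rewrite cq cp'; move: (cp j) wmE; move: (count_mem j _) => N.
  have [->|nj] := eqVneq j m.
    rewrite ltnn leqnn leqnSn ltnSn !andbT.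
    have gap : (m.+1 == m) = false by rewrite gtn_eqF.
    have top u : u <= m.+1 -> (minn u m == m :> nat) = (u == m) + (u == m.+1) :> nat.
      rewrite leq_eqVlt => /orP[/eqP->|um]; first by rewrite (minn_idPr (leqnSn m)) gap !eqxx.
      by rewrite (minn_idPl (um : u <= m)) (ltn_eqF um) addn0.
    have apart u : (u == m.+1) && (u == m) = false.
      by case: eqP => // ->; rewrite gap.
    rewrite gap !top // !apart muln0 !addn0 [b * _]muln1 !doubleD.
    move: (if 0 < m then _ else _) (w m) (nat_of_bool (s == m)) (nat_of_bool (t == m)).
    move: (nat_of_bool (s == m.+1)) (nat_of_bool (t == m.+1)) => A1 A2 A3 A4 A5 A6.
    by clear; lia.
  have low u : (minn u m == m.+1) = false by rewrite ltn_eqF // ltnS geq_minr.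
  have [->|nj'] := eqVneq j m.+1.
    rewrite !ltnn leqnn /= ltnNge leqnSn /= !low !andbb muln0 muln1 !addn0.
    move: (nat_of_bool (s == _)) (nat_of_bool (t == _)) (w m) => A1 A2 wm.
    by clear; lia.
  have mid u : u <= m.+1 -> (minn u m == j) = (u == j).
    rewrite leq_eqVlt => /orP[/eqP->|um]; last by rewrite (minn_idPl (um : u <= m)).
    by rewrite (minn_idPr (leqnSn m)) ![_ == j]eq_sym (negbTE nj) (negbTE nj').
  have apart u : (u == m.+1) && (u == j) = false.
    by case: eqP => // ->; rewrite eq_sym (negbTE nj').
  have -> : (j < m.+1) = (j < m) by rewrite ltnS leq_eqVlt (negbTE nj).
  have -> : (j <= m.+1) = (j <= m) by rewrite leq_eqVlt (negbTE nj').
  by rewrite !mid // !apart !muln0 !addn0 => ->.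
case: (eqVneq s m.+1) => [sm|nsm].
  exists (minn s m :: q); split=> //=; first by rewrite pq andbT /adjn; lia.
  by move=> j; rewrite -fin sm eqxx /=; lia.
have sE : minn s m = s by lia.
rewrite sE in pq lq fin; exists q; split=> // j.
by rewrite -fin (negbTE nsm) /= addn0.
Qed.

(** * Lifting a walk on the layers to a path *)

Section Thread.
Variables (T : eqType) (r : rel T) (lay : T -> nat).
Hypothesis r_lay : forall u v, adjn (lay u) (lay v) -> r u v.

Definition piece (j : nat) (q : seq T) :=
  if q is x :: p then path r x p && all (fun z => lay z == j) q else false.

(* The successive visits of the walk to the layer [j] use up the list [P j]. *)
Lemma thread_pieces (w : seq nat) (s : nat) (P : nat -> seq (seq T)) :
  path adjn s w ->
  (forall j, size (P j) = count_mem j (s :: w)) ->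
  (forall j, all (piece j) (P j)) ->
  exists2 c : seq T * T, path r c.2 c.1 &
    [/\ ohead (head [::] (P s)) = Some c.2,
        forall d, last d (last [::] (P (last s w))) = last c.2 c.1
      & forall z, count_mem z (c.2 :: c.1) = count_mem z (flatten (P (lay z)))].
Proof.
have out j q z : all (fun u => lay u == j) q -> j != lay z -> count_mem z q = 0.
  move=> allq nz; apply/count_memPn; apply: contra nz => zq.
  by rewrite eq_sym (allP allq).
elim: w s P => [|s2 w IH] s P pw szP allPP.
  have: size (P s) = 1 by rewrite szP /= eqxx.
  case Ps: (P s) => [|q []] // _.
  have := allPP s; rewrite Ps /= andbT; case: q Ps => // x p Ps.
  case/andP=> px alls; exists (p, x) => //=; split=> // z; rewrite ?Ps //.
  have [<-|nz] := eqVneq s (lay z); first by rewrite Ps /= cats0.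
  have -> : P (lay z) = [::].
    by apply: size0nil; rewrite szP /= (negbTE nz).
  exact: (out s (x :: p)).
have ns : s2 != s by move: pw; rewrite /= /adjn; lia.
have: 0 < size (P s) by rewrite szP /= eqxx.
case Ps: (P s) => [|q Q] // _.
have := allPP s; rewrite Ps /= => /andP[]; case: q Ps => // x p Ps /andP[px alls] allQ.
(* The first visit consumes the first piece of the layer [s]; the rest of the walk uses what
   remains. *)
pose P' j := if j == s then Q else P j.
have szP' j : size (P' j) = count_mem j (s2 :: w).
  have := szP j; rewrite /P' /=; case: (eqVneq j s) => [->|nj] /=.
    by rewrite Ps /=; lia.
  by move=> ->; rewrite eq_sym.
have allP' j : all (piece j) (P' j) by rewrite /P'; case: eqP => // ->.
have [|[c' y] /= pc [hc lc cc]] := IH s2 P' _ szP' allP'; first by case/andP: pw.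
have lay_y : lay y = s2.
  move: hc (allPP s2); rewrite /P' (negbTE ns); case: (P s2) => // -[|z q] //= ? [<-].
  by case/andP; case/and3P => _ /eqP.
exists (p ++ y :: c', x) => /=.
  rewrite cat_path px /= pc andbT; apply: r_lay; rewrite lay_y.
  have -> : lay (last x p) = s by apply/eqP; exact: (allP alls _ (mem_last x p)).
  by case/andP: pw.
split=> //.
  (* If the walk ends in [s], a visit to [s] remains, so [Q] is not empty and has the same last
     piece as [P s]. *)
  move=> d; rewrite last_cat /= -(lc d) /P'; case: eqP => // lastE.
  have : 0 < size (P' (last s2 w)) by rewrite szP' -has_count has_pred1 mem_last.
  by rewrite lastE /P' eqxx Ps; case: (Q).
move=> z; rewrite /= count_cat /= cc /P'; case: (eqVneq (lay z) s) => [->|nz].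
  by rewrite Ps /= count_cat; lia.
by have /= := out s (x :: p) z alls; rewrite eq_sym nz => /(_ isT); lia.
Qed.
End Thread.

(** * Linear forests and listings of the vertices *)

Lemma pair_sum_nth (T : Type) (x0 : T) (f : T -> T -> nat) (s : seq T) :
  pair_sum f s = \sum_(i < (size s).-1) f (nth x0 s i) (nth x0 s i.+1).
Proof.
elim: s => [|x [|y s] IH]; rewrite ?big_ord0 //.
by rewrite -[LHS]/(f x y + pair_sum f (y :: s)) IH big_ord_recl.
Qed.

Lemma set2_cases (T : finType) (a b c d : T) : a != b ->
  [set a; b] = [set c; d] -> (a = c /\ b = d) \/ (a = d /\ b = c).
Proof.
move=> nab E.
have : a \in [set c; d] by rewrite -E set21.
have : b \in [set c; d] by rewrite -E set22.
rewrite !inE => /orP[]/eqP eb /orP[]/eqP ea; [|by right|by left|].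
  by rewrite ea eb eqxx in nab.
by rewrite ea eb eqxx in nab.
Qed.

(** In a cycle, the vertex of highest position has two distinct neighbours, and both would have to
    sit one position below it. *)
Lemma positions_forest (G' : sgraph) (pos : G' -> nat) : injective pos ->
  (forall x y : G', sedge x y -> adjn (pos x) (pos y)) -> is_forest G'.
Proof.
move=> pos_inj pos_adj; apply/forallP => m; apply/forallP => c.
apply/implyP => m3; apply/negP => /andP[cc cu].
have sc : 2 < size c by rewrite size_tuple.
move: (tval c) cc cu sc => {}c cc cu sc {m m3}.
have [x xc xmax] : exists2 x, x \in c & forall y, y \in c -> pos y <= pos x.
  case: c sc {cc cu} => // x0' c _.
  case: (@arg_maxnP _ x0' (mem (x0' :: c)) pos); first exact: mem_head.
  by move=> x xc xm; exists x.
have [i p E] := rot_to xc.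
have mp y : y \in x :: p -> pos y <= pos x by rewrite -E mem_rot; apply: xmax.
have : cycle (@sedge G') (x :: p) by rewrite -E rot_cycle.
have : uniq (x :: p) by rewrite -E rot_uniq.
have : 2 < size (x :: p) by rewrite -E size_rot.
case: p mp {E} => [|y [|z p]] // mp _.
rewrite /= rcons_path => /and4P[_ yzp _ _] /and3P[exy _ /andP[_ elx]].
have [ay al] := (pos_adj _ _ exy, pos_adj _ _ elx).
have py : pos y <= pos x by apply: mp; rewrite !inE eqxx orbT.
have pl : pos (last z p) <= pos x by apply: mp; rewrite 2!in_cons mem_last !orbT.
have : y = last z p.
  apply: pos_inj; move: (pos x) (pos y) (pos (last z p)) ay al py pl => a b d.
  by rewrite /adjn; lia.
by move=> E; rewrite E mem_last in yzp.
Qed.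

(** * The linear forest carried by a listing *)

Section ListedEdges.
Variables (G : sgraph) (x0 : G) (L : seq G).
Let v := nth x0 L.

(** For a listing of all the vertices without repetition this is a linear forest, whose paths are
    the maximal runs of adjacent entries. The bound [(size L).-1] keeps [i.+1] in range, so the
    default [x0] is never read. *)
Definition listed_edges : {set {set G}} :=
  [set [set v i; v i.+1] | i : 'I_(size L).-1 & sedge (v i) (v i.+1)].

Lemma card_listed_steps :
  #|[pred i : 'I_(size L).-1 | sedge (v i) (v i.+1)]| = pair_sum (@sedge G) L.
Proof. by rewrite (pair_sum_nth x0) -sum1_card big_mkcond. Qed.

Lemma card_listed_edges : #|listed_edges| <= pair_sum (@sedge G) L.
Proof.
rewrite -card_listed_steps; apply: leq_trans (leq_imset_card _ _) _.
by apply: subset_leq_card; apply/subsetP => i; rewrite !inE.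
Qed.

Hypotheses (L_uniq : uniq L) (L_full : forall z, z \in L).
Let N := size L.

Let v_inj i j : i < N -> j < N -> v i = v j -> i = j.
Proof. by move=> iN jN /eqP; rewrite nth_uniq // => /eqP. Qed.

Let v_index z : v (index z L) = z. Proof. exact: nth_index. Qed.
Let index_N z : index z L < N. Proof. by rewrite index_mem. Qed.

Lemma card_listed_edges_eq : #|listed_edges| = pair_sum (@sedge G) L.
Proof.
rewrite -card_listed_steps card_in_imset.
  by apply: eq_card => i; rewrite !inE.
move=> i j _ _ /set2_cases E.
have [iN jN] : i.+1 < N /\ j.+1 < N.
  by have := ltn_ord i; have := ltn_ord j; rewrite -/N; lia.
have [iN' jN'] := (ltnW iN, ltnW jN).
case: E => [|[ei _]|[ei ej]].
- by rewrite nth_uniq // ltn_eqF.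
- by apply/val_inj; apply: v_inj ei.
- by have := v_inj iN' jN ei; have := v_inj iN jN' ej; lia.
Qed.

Lemma listed_edgesE a b : a < N -> b < N ->
  spanning_rel listed_edges (v a) (v b) = adjn a b && sedge (v a) (v b).
Proof.
move=> aN bN; rewrite /spanning_rel nth_uniq //; apply/andP/andP=> -[].
  move=> nab /imsetP[i]; rewrite inE => ei /set2_cases E.
  have iN : i.+1 < N by have := ltn_ord i; rewrite -/N; lia.
  have iN' := ltnW iN.
  case: E => [|[/v_inj ea /v_inj eb]|[/v_inj ea /v_inj eb]].
  - by rewrite nth_uniq.
  - by rewrite (ea aN iN') (eb bN iN) /adjn eqxx.
  - by rewrite (ea aN iN) (eb bN iN') /adjn eqxx orbT sedge_sym.
case/orP=> /eqP E; subst => e; split.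
- by rewrite ltn_eqF.
- have aN' : a < (size L).-1 by rewrite -/N -ltnS prednK // (leq_trans _ bN).
  by apply/imsetP; exists (Ordinal aN'); rewrite ?inE.
- by rewrite gtn_eqF.
have bN' : b < (size L).-1 by rewrite -/N -ltnS prednK // (leq_trans _ aN).
apply/imsetP; exists (Ordinal bN') => /=.
  by rewrite inE sedge_sym.
by rewrite setUC.
Qed.

Let D := spanning_subgraph listed_edges.

Lemma listed_adjn (x y : D) : sedge x y -> adjn (index x L) (index y L).
Proof.
rewrite -{1}(v_index x) -{1}(v_index y) /= listed_edgesE ?index_N //.
by case/andP.
Qed.

Let ok j := (j.+1 < N) && sedge (v j) (v j.+1).

(** The maximal run around the position [i], extended to the left by induction on [i] and to the
    right by induction on the distance to the end. *)
Let interval i : i < N -> exists a b, [/\ a <= i <= b, b < N,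
  forall j, a <= j < b -> ok j, ~~ ok b & forall j, j.+1 = a -> ~~ ok j].
Proof.
move=> iN.
have [a [ai aok amin]] : exists a, [/\ a <= i,
    forall j, a <= j < i -> ok j & forall j, j.+1 = a -> ~~ ok j].
  elim: i iN => [|i IH] iN; first by exists 0; split=> // j; lia.
  have [a [ai aok amin]] := IH (ltnW iN).
  case oki: (ok i); last first.
    by exists i.+1; split=> // j; [lia | case=> ->; rewrite oki].
  exists a; split=> // [|j]; first exact: leqW.
  by have [->|] := eqVneq j i; [rewrite oki | move=> ? ?; apply: aok; lia].
have [b [ib bN bok bmax]] : exists b, [/\ i <= b, b < N,
    forall j, i <= j < b -> ok j & ~~ ok b].
  have [d] : exists d, i + d = N.-1 by exists (N.-1 - i); lia.
  elim: d i iN {a ai aok amin} => [|d IH] i iN E.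
    exists i; split=> // [j|]; first by lia.
    by rewrite /ok; apply/negP; lia.
  case oki: (ok i); last by exists i; rewrite oki; split=> // j; lia.
  have [||b [ib bN bok bmax]] := IH i.+1; try lia.
  exists b; split=> // [|j]; first exact: ltnW.
  by have [->|] := eqVneq j i; [rewrite oki | move=> ? ?; apply: bok; lia].
exists a, b; split=> //; first by rewrite ai.
by move=> j jab; have [ji|ij] := ltnP j i; [apply: aok | apply: bok]; lia.
Qed.

(** Positions in the listing exclude cycles. A component is a maximal run from [a] to [b]: steps
    inside it are edges, no edge leaves it, and the shift by [a] identifies it with a path graph. *)
Lemma listed_linear_forest : is_linear_forest D.
Proof.
apply/andP; split.
  apply: (positions_forest (pos := fun x : D => index x L)) listed_adjn.
  by move=> x y E; rewrite -(v_index x) E v_index.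
apply/forallP => x; set S := component x.
have [a [b [/andP[ai ib] bN inok bmax amin]]] := interval (index_N x).
have conn l : a + l <= b -> connect (@sedge D) (v a) (v (a + l)).
  elim: l => [|l IH] le_l; first by rewrite addn0 connect0.
  apply: connect_trans (IH _) (connect1 _); first by lia.
  have /andP[_ e] : ok (a + l) by apply: inok; lia.
  by rewrite /= addnS listed_edgesE /adjn ?eqxx //; lia.
have csym := sym_connect_sym (@sedge_sym D).
have SE y : (y \in S) = (a <= index y L <= b).
  rewrite inE; apply/idP/idP => [xy|/andP[ay yb]].
    have cl : closed (@sedge D) [pred z | a <= index z L <= b].
      apply: (intro_closed csym) => z y' e /andP[az zb].
      move: e; rewrite -{1}(v_index z) -{1}(v_index y') /= listed_edgesE ?index_N //.
      move: (index_N y'); rewrite inE.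
      move: (index z L) (index y' L) az zb => p q ap pb qN /andP[/orP[]/eqP E e].
        have : p != b by apply: contraNneq bmax => <-; rewrite /ok E qN.
        lia.
      have : p != a.
        by apply/eqP => pa; have := amin q; rewrite E pa /ok E sedge_sym e andbT; lia.
      lia.
    rewrite -[_ && _]/(y \in [pred z | a <= index z L <= b]).
    by rewrite -(closed_connect cl xy) inE ai ib.
  have h z : a <= index z L <= b -> connect (@sedge D) (v a) z.
    case/andP=> az zb; rewrite -[z]v_index -(subnKC az).
    by apply: conn; rewrite subnKC.
  by apply: connect_trans (h y _); rewrite ?ay // csym h // ai.
have vN l : l <= b - a -> a + l < N by lia.
have idx l : l <= b - a -> index (v (a + l)) L = a + l.
  by move=> /vN lN; apply: index_uniq.
have S_card : #|S| = (b - a).+1.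
  have -> : S = [set (v (a + l) : D) | l : 'I_(b - a).+1].
    apply/setP => y; rewrite SE; apply/idP/imsetP => [/andP[ay yb]|[l _ ->]].
      have lt : index y L - a < (b - a).+1 by lia.
      by exists (Ordinal lt); rewrite //= subnKC ?v_index.
    by have := ltn_ord l; rewrite ltnS => ll; rewrite idx //; lia.
  rewrite card_imset ?card_ord // => l l' /v_inj E; apply/val_inj/(@addnI a).
  by apply: E; apply: vN; rewrite -ltnS.
apply/existsP; exists [ffun l : 'I_#|S| => (v (a + l) : D)].
have ll (l : 'I_#|S|) : l <= b - a by rewrite -ltnS -S_card.
have lN (l : 'I_#|S|) : a + l < N by apply: vN.
apply/and3P; split.
- apply/injectiveP => l l'; rewrite !ffunE => /v_inj E; apply/val_inj => /=.
  exact: (addnI (E (lN l) (lN l'))).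
- apply/eqP/setP => y; rewrite SE; apply/imsetP/idP => [[l _ ->]|/andP[ay yb]].
    by have := ll l; rewrite ffunE idx //; lia.
  have lt : index y L - a < #|S| by lia.
  by exists (Ordinal lt); rewrite // ffunE /= subnKC ?v_index.
- apply/forallP => l; apply/forallP => l'; rewrite !ffunE /= listed_edgesE //.
  apply/eqP; have -> : adjn (a + l) (a + l') = (l.+1 == l') || (l'.+1 == l).
    by rewrite /adjn; lia.
  case E: (_ || _) => //=.
  have [l1 l2] := (ll l, ll l').
  case/orP: E => /eqP E.
    have /andP[_] : ok (a + l) by apply: inok; rewrite leq_addr -ltn_subRL E l2.
    by rewrite -addnS E.
  have /andP[_] : ok (a + l') by apply: inok; rewrite leq_addr -ltn_subRL E l1.
  by rewrite sedge_sym -addnS E.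
Qed.
End ListedEdges.

Lemma pair_sum_le_linear_forest_number (G : sgraph) (L : seq G) :
  uniq L -> (forall z, z \in L) ->
  pair_sum (@sedge G) L <= linear_forest_number G.
Proof.
case: L => [|x0 L] // uL fL; rewrite -(card_listed_edges_eq x0) //.
apply: leq_bigmax_cond; rewrite listed_linear_forest // andbT.
apply/subsetP => E /imsetP[i]; rewrite inE => e ->.
apply/imsetP; exists (nth x0 (x0 :: L) i, nth x0 (x0 :: L) i.+1) => //.
by rewrite inE.
Qed.

(** Each component is listed along its path and these lists are concatenated. An edge of [F] joins
    consecutive vertices of its component, hence consecutive entries of [L]. *)
Lemma linear_forest_enumeration (G : sgraph) (F : {set {set G}}) :
  F \subset edge_set G -> is_linear_forest (spanning_subgraph F) ->
  exists L : seq G,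
    [/\ uniq L, forall z, z \in L & #|F| <= pair_sum (@sedge G) L].
Proof.
move=> FE /andP[_ /forallP paths]; set D := spanning_subgraph F.
pose comps := [set component x | x : D].
(* The premise [S \in comps] makes the property satisfiable for every set, so that one function [q]
   can be chosen for all. *)
pose good (S : {set D}) (q : seq G) := S \in comps ->
    [/\ uniq q, q =i S
      & forall (x0 x y : G), x \in S -> y \in S -> spanning_rel F x y ->
        exists2 i, i.+1 < size q
                   & [set x; y] = [set nth x0 q i; nth x0 q i.+1]].
have [q qP] : exists q : {set D} -> seq G, forall S, good S (q S).
  apply: (@fin_all_exists _ (fun=> seq G)) => S; rewrite /good.
  have [/imsetP[z _ ->]|_] := boolP (S \in comps); last by exists [::].
  have /existsP[f /and3P[/injectiveP f_inj /eqP fS /forallP fadj]] := paths z.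
  have memf : [seq f i | i <- enum 'I_#|component z|] =i component z.
    move=> y; rewrite -[in RHS]fS; apply/mapP/imsetP => -[i _ ->]; exists i => //.
    by rewrite mem_enum.
  exists [seq f i | i <- enum 'I_#|component z|] => _; split=> //.
    by rewrite map_inj_uniq ?enum_uniq.
  move=> x0 x y; rewrite -!memf => /mapP[i _ ->] /mapP[j _ ->] exy.
  have nthf (l : 'I_#|component z|) :
      nth x0 [seq f i | i <- enum 'I_#|component z|] l = f l.
    by rewrite (nth_map l) ?nth_ord_enum // size_enum_ord.
  have := forallP (fadj i) j; rewrite [sedge _ _]exy eq_sym eqb_id /= size_map size_enum_ord.
  case/orP => /eqP E; [exists i | exists j]; rewrite ?E //; try by rewrite !nthf.
  by rewrite !nthf setUC.
pose L := flatten [seq q X | X <- enum comps].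
have comp_eq (x y : D) : y \in component x -> component x = component y.
  rewrite inE => xy; apply/setP => z; rewrite !inE.
  exact: (same_connect (sym_connect_sym (@sedge_sym D)) xy).
have self (x : D) : x \in component x by rewrite inE connect0.
have comp_in (x : D) : component x \in comps by exact: imset_f.
have countL z : count_mem z L = 1.
  rewrite count_flatten -map_comp sumnE big_map big_enum /=.
  rewrite (bigD1 (component (z : D))) //= big1 => [|S /andP[Sc nS]].
    have [u m _] := qP _ (comp_in z).
    by rewrite addn0 count_uniq_mem // m self.
  have [u m _] := qP _ Sc; rewrite count_uniq_mem // m.
  case zS: (z \in S) => //; case/imsetP: Sc zS nS => x _ -> /comp_eq ->.
  by rewrite eqxx.
have fullL z : z \in L by rewrite -has_pred1 has_count countL.
exists L; split=> //.
  by apply: count_mem_uniq => z; rewrite countL fullL.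
(* The default vertex for [nth] is taken from an edge, so the empty [F] is set apart. *)
have [->|[E0 E0F]] := set_0Vmem F; first by rewrite cards0.
have /imsetP[[x0 ?] _ _] := subsetP FE _ E0F.
apply: leq_trans (card_listed_edges x0 L); apply: subset_leq_card.
apply/subsetP => E EF; have /imsetP[[x y]] := subsetP FE _ EF.
rewrite inE /= => exy EE; subst E.
have nxy : x != y by apply: contraTneq exy => ->; rewrite sedge_irr.
have sxy : spanning_rel F x y by rewrite /spanning_rel nxy.
have [_ _ qnth] := qP _ (comp_in x).
have [||i isz Eq] := qnth x0 x y _ _ sxy; first exact: self.
  by rewrite inE connect1.
have [s1 [s2 LE]] : exists s1 s2, L = s1 ++ q (component (x : D)) ++ s2.
  have : component (x : D) \in enum comps by rewrite mem_enum.
  rewrite /L; case/splitPr => c1 c2.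
  exists (flatten (map q c1)), (flatten (map q c2)).
  by rewrite map_cat flatten_cat.
have nthL j : j < size (q (component (x : D))) ->
    nth x0 L (size s1 + j) = nth x0 (q (component (x : D))) j.
  by move=> jsz; rewrite LE nth_cat ltnNge leq_addr /= addKn nth_cat jsz.
have iL : size s1 + i < (size L).-1 by rewrite LE !size_cat; lia.
apply/imsetP; exists (Ordinal iL); rewrite /= -?addnS ?nthL ?(ltnW isz) //.
rewrite inE /= -addnS !nthL ?(ltnW isz) //.
by case: (set2_cases nxy Eq) => -[<- <-] //; rewrite sedge_sym.
Qed.

(** The property passes to the larger of two numbers, so it is enough to have it for 0 and for each
    linear forest. *)
Lemma linear_forest_number_enumeration (G : sgraph) :
  exists L : seq G, [/\ uniq L, forall z, z \in L
    & linear_forest_number G <= pair_sum (@sedge G) L].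
Proof.
apply: (big_ind (fun m => exists L : seq G,
  [/\ uniq L, forall z, z \in L & m <= pair_sum (@sedge G) L])).
- by exists (enum G); split=> [||//]; [exact: enum_uniq | move=> z; rewrite mem_enum].
- move=> m1 m2 [L1 [u1 f1 le1]] [L2 [u2 f2 le2]].
  have [le12|le21] := leqP (pair_sum (@sedge G) L1) (pair_sum (@sedge G) L2).
    by exists L2; split=> //; rewrite geq_max le2 andbT (leq_trans le1).
  by exists L1; split=> //; rewrite geq_max le1 (leq_trans le2) // ltnW.
- by move=> F /andP[FE lin]; apply: linear_forest_enumeration.
Qed.

(** * The walk through the layers *)

Lemma sum_ord_head (f : nat -> nat) i : f 0 <= \sum_(l < i.+1) f l.
Proof. by rewrite big_ord_recl leq_addr. Qed.

Lemma sum_ord_tail (f : nat -> nat) i k : i < k ->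
  \sum_(l < i.+1) f l + f k <= \sum_(l < k.+1) f l.
Proof.
move=> ik; rewrite [X in _ <= X]big_ord_recr leq_add2r.
by elim: k ik => // k IH; rewrite ltnS leq_eqVlt => /orP[/eqP->//|/IH le];
  rewrite big_ord_recr; apply: leq_trans le _; apply: leq_addr.
Qed.

Lemma sum_eq_even s i :
  \sum_(l < i) (s == 2 * l) = ~~ odd s && (s < 2 * i).
Proof.
by elim: i => [|i IH]; rewrite ?big_ord0 ?big_ord_recr /= ?IH; lia.
Qed.

Lemma sum_eq_odd s i :
  \sum_(l < i) (s == (2 * l).+1) = odd s && (s < 2 * i).
Proof.
by elim: i => [|i IH]; rewrite ?big_ord0 ?big_ord_recr /= ?IH; lia.
Qed.

Section LayerWalk.
Variables (k n s t : nat) (e : nat -> nat).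
Hypotheses (k_gt0 : 0 < k) (s_le : s <= 2 * k) (t_le : t <= 2 * k).
Hypothesis e_odd : forall j, odd j -> e j = 0.
(** A walk alternates between even and odd layers, so its visits to the even ones must number
    [k * n - 1] plus the number of ends in even layers. *)
Hypothesis e_sum :
  \sum_(i < k.+1) e (2 * i) + ~~ odd s + ~~ odd t = n + 1.
(** Equivalently, [2 * e 0] plus the ends in the layer 0 exceeds the ends in odd layers; this lets
    the walk go beyond the layer 1. [e_last] is the mirror image. *)
Hypothesis e_first : 3 <= 2 * e 0 + (s == 0) + (t == 0) + ~~ odd s + ~~ odd t.
Hypothesis e_last :
  3 <= 2 * e (2 * k) + (s == 2 * k) + (t == 2 * k) + ~~ odd s + ~~ odd t.

(** A visit takes two steps, less one for each end of the walk, so the steps on both sides of [j]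
    add up to [2 * (n - e j)] minus the ends in [j]. Alternating sums solve this in terms of kept
    edges ([S]), ends in even layers ([A]) and ends in odd layers ([B]). *)
Let S i := \sum_(l < i) e (2 * l).
Let A i := \sum_(l < i) (s == 2 * l) + \sum_(l < i) (t == 2 * l).
Let B i := \sum_(l < i) (s == (2 * l).+1) + \sum_(l < i) (t == (2 * l).+1).

(* The number of steps between the layers [j] and [j.+1] is forced by the    *)
(* number [n - e j] of visits to each layer [j].                             *)
Let w j := if odd j then 2 * S j./2.+1 + A j./2.+1 - B j./2.+1
           else 2 * n + B j./2 - 2 * S j./2.+1 - A j./2.+1.

Let SS i : S i.+1 = S i + e (2 * i). Proof. exact: big_ord_recr. Qed.
Let AS i : A i.+1 = A i + (s == 2 * i) + (t == 2 * i).
Proof. by rewrite /A !big_ord_recr /= addnACA addnA. Qed.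
Let BS i : B i.+1 = B i + (s == (2 * i).+1) + (t == (2 * i).+1).
Proof. by rewrite /B !big_ord_recr /= addnACA addnA. Qed.

Let Aend : A k.+1 = ~~ odd s + ~~ odd t.
Proof.
rewrite /A !sum_eq_even.
have -> : s < 2 * k.+1 by move: s_le; clear; lia.
have -> : t < 2 * k.+1 by move: t_le; clear; lia.
by rewrite !andbT.
Qed.
Let Ble i : B i <= odd s + odd t.
Proof.
by rewrite /B !sum_eq_odd; apply: leq_add; case: (odd _) => //; apply: leq_b1.
Qed.
Let Bend : B k = odd s + odd t.
Proof.
rewrite /B !sum_eq_odd; congr (_ + _).
  by case os: (odd s) => //=; have -> : s < 2 * k by move: s_le os; clear; lia.
by case os: (odd t) => //=; have -> : t < 2 * k by move: t_le os; clear; lia.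
Qed.

Let w_even i : w (2 * i) = 2 * n + B i - 2 * S i.+1 - A i.+1.
Proof. by rewrite /w mul2n odd_double doubleK. Qed.
Let w_oddE i : w (2 * i).+1 = 2 * S i.+1 + A i.+1 - B i.+1.
Proof. by rewrite /w mul2n /= odd_double uphalf_double. Qed.

(** The total of [2 * S + A] over all the even layers is fixed by [e_sum], and by [e_last] the last
    layer takes enough of it. *)
Let even_lt i : i < k -> 2 * S i.+1 + A i.+1 < 2 * n.
Proof.
move=> ik; have := sum_ord_tail (fun l => e (2 * l)) ik; rewrite -/(S i.+1) -/(S k.+1).
have := sum_ord_tail (fun l => (s == 2 * l) + (t == 2 * l)) ik.
rewrite !big_split /= -/(A i.+1) -/(A k.+1) Aend.
move: e_sum e_last; rewrite -/(S k.+1).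
move: (S i.+1) (S k.+1) (A i.+1) (~~ odd s) (~~ odd t) (e (2 * k)) => S1 S2 A1 a b e1.
move: (nat_of_bool (s == 2 * k)) (nat_of_bool (t == 2 * k)) => c d.
by move: (nat_of_bool a) (nat_of_bool b) => a' b'; clear; lia.
Qed.

(** By [e_first], the layer 0 alone outweighs all the ends in odd layers. *)
Let odd_lt i : B i.+1 < 2 * S i.+1 + A i.+1.
Proof.
have := sum_ord_head (fun l => e (2 * l)) i; rewrite -/(S i.+1).
have := sum_ord_head (fun l => (s == 2 * l) + (t == 2 * l)) i.
rewrite !big_split /= -/(A i.+1) muln0; have := Ble i.+1; move: e_first.
move: (S i.+1) (A i.+1) (B i.+1) (e 0) (s == 0) (t == 0) => S1 A1 B1 e0 c d.
have oddD (b : bool) : b + ~~ b = 1 by case: b.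
move: (oddD (odd s)) (oddD (odd t)) (nat_of_bool c) (nat_of_bool d) => + + c' d'.
move: (nat_of_bool (odd s)) (nat_of_bool (odd t)) => a b.
by move: (nat_of_bool _) (nat_of_bool _) => a' b'; clear; lia.
Qed.

Let w_gt0 j : j < 2 * k -> 0 < w j.
Proof.
rewrite -[j]odd_double_half -mul2n; case: (odd j) => /= jk.
  by rewrite add1n w_oddE subn_gt0 odd_lt.
rewrite add0n w_even -subnDA subn_gt0; apply: leq_trans (leq_addr _ _).
by apply: even_lt; move: jk; rewrite add0n ltn_pmul2l.
Qed.

Let closed_even i : B i + A i.+1 = (s <= 2 * i) + (t <= 2 * i).
Proof.
rewrite /A /B !sum_eq_even !sum_eq_odd.
have h u : (odd u && (u < 2 * i)) + (~~ odd u && (u < 2 * i.+1)) = (u <= 2 * i).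
  rewrite -[u]odd_double_half oddD odd_double addbF oddb -mul2n.
  by case: (odd u); rewrite /= ?addn0 ?add0n; congr nat_of_bool; clear; lia.
by rewrite -!h addnACA.
Qed.

Let closed_odd i : B i.+1 + A i.+1 = (s <= (2 * i).+1) + (t <= (2 * i).+1).
Proof.
rewrite /A /B !sum_eq_even !sum_eq_odd.
have h u : (odd u && (u < 2 * i.+1)) + (~~ odd u && (u < 2 * i.+1)) = (u <= (2 * i).+1).
  by case: (odd u); rewrite /= ?addn0 ?add0n; congr nat_of_bool; clear; lia.
by rewrite -!h addnACA.
Qed.

(** The strict inequalities above make the truncated subtractions exact, so modulo 2 only [A] and
    [B] remain, which together count the ends in layers up to [j]. *)
Let w_parity j : j < 2 * k -> odd (w j) = (s <= j) (+) (t <= j).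
Proof.
have hb (a b : bool) : odd (a + b) = a (+) b by case: a; case: b.
rewrite -[j]odd_double_half -mul2n; case: (odd j) => jk.
  rewrite add1n w_oddE -hb -closed_odd; have := odd_lt j./2.
  by move: (S _) (A _) (B _) => S1 A1 B1; clear; lia.
rewrite add0n w_even -hb -closed_even; have /even_lt : j./2 < k by move: jk; rewrite add0n ltn_pmul2l.
by move: (S _) (A _) (B _) => S1 A1 B1; clear; lia.
Qed.

Lemma layer_walk : exists p, [/\ path adjn s p, last s p = t
  & forall j, count_mem j (s :: p) = if j <= 2 * k then n - e j else 0].
Proof.
have [p [pp lp cp]] := euler_walk s_le t_le w_gt0 w_parity.
exists p; split=> // j; move: (cp j); move: (count_mem j _) => N.
have [jk|kj] := leqP j (2 * k); last first.
  rewrite andbF ltnNge (ltnW kj) /=.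
  rewrite (ltn_eqF (leq_ltn_trans s_le kj)) (ltn_eqF (leq_ltn_trans t_le kj)).
  by clear; lia.
move: jk; rewrite andbT -[j]odd_double_half -mul2n; case: (odd j).
  rewrite add1n => jk; rewrite /= e_odd ?subn0; last by rewrite /= mul2n odd_double.
  have jk' : j./2 < k by rewrite -(ltn_pmul2l (isT : 0 < 2)).
  rewrite w_even; have := even_lt jk'; have := odd_lt j./2.
  have -> : (2 * j./2).+1 < 2 * k by move: jk'; clear; lia.
  by rewrite w_oddE BS; move: (S _) (A _) (B _) => S1 A1 B1; clear; lia.
rewrite add0n; case: (j./2) => [|i] jk.
  have := even_lt k_gt0; have := w_even 0; rewrite !muln0 => -> /=.
  rewrite muln_gt0 k_gt0 AS SS muln0 /S /A /B !big_ord0.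
  by rewrite /=; clear; lia.
have -> : 0 < 2 * i.+1 by [].
have -> : (2 * i.+1).-1 = (2 * i).+1 by rewrite mulnS.
have := odd_lt i; rewrite w_oddE w_even => h1.
have [ik|ki] := ltnP i.+1 k.
  have -> : 2 * i.+1 < 2 * k by rewrite ltn_pmul2l.
  move: (even_lt ik); rewrite (SS i.+1) (AS i.+1).
  by move: (S _) (A _) (B _) h1 => S1 A1 B1; clear; lia.
have ik : i.+1 = k by apply/eqP; rewrite eqn_leq ki andbT -(leq_pmul2l (isT : 0 < 2)).
rewrite ik in h1 *; rewrite ltnn.
(* No step leads beyond the last layer, so its number of visits comes out right only through
   [e_sum]. *)
have := e_sum; rewrite -/(S k.+1) SS; have := Aend; rewrite AS.
move: h1; rewrite Bend; move: (S _) (A _) => S1 A1; clear.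
by case: (odd s); case: (odd t) => /=; lia.
Qed.
End LayerWalk.

(** * Hamiltonian paths of the product *)

Lemma last_flatten (T : Type) (d : T) (Q : seq (seq T)) :
  all (fun q => ~~ nilp q) Q -> last d (flatten Q) = last d (last [::] Q).
Proof.
case/lastP: Q => // Q q; rewrite all_rcons flatten_rcons last_rcons last_cat.
by case: q.
Qed.

Lemma count_Tagged (I : eqType) (T_ : I -> eqType) (i : I) (a : T_ i) (s : seq (T_ i)) :
  count_mem (Tagged T_ a) [seq Tagged T_ z | z <- s] = count_mem a s.
Proof.
by rewrite count_map; apply: eq_count => z /=; rewrite eq_sym eq_Tagged /= eq_sym.
Qed.

Definition lex_vertex (G : sgraph) (H : G -> sgraph) (u : G) (a : H u) :
  lex_product H := Tagged H a.

Lemma lex_vertex_inj (G : sgraph) (H : G -> sgraph) (u : G) :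
  injective (@lex_vertex G H u).
Proof. by move=> a b /eqP; rewrite eq_Tagged => /eqP. Qed.

Lemma lex_vertex_adj (G : sgraph) (H : G -> sgraph) (u : G) (a b : H u) :
  sedge (lex_vertex a) (lex_vertex b) = sedge a b.
Proof. by rewrite /= /lex_rel tagged_asE eqxx sedge_irr. Qed.

Section LexPath.
Variables (k n : nat) (H : 'I_(2 * k).+1 -> sgraph).
Hypotheses (k_gt0 : 0 < k) (n_gt0 : 0 < n).
Hypothesis card_H : forall i, #|H i| = n.

Local Notation V := (@lex_product (path_graph (2 * k).+1) H).
Local Notation vtx := (@lex_vertex (path_graph (2 * k).+1) H _).

(** Layer [i] is cut into [n - e i] paths, which is how often [layer_walk] visits it, and
    [thread_pieces] follows one path per visit. The conditions on [L s] and [L t] put [x] and [y] at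
    the two ends. *)
Lemma lex_ham_path (s t : 'I_(2 * k).+1) (L : forall i, seq (H i))
    (e : nat -> nat) (x : H s) (y : H t) :
  (forall i, uniq (L i)) -> (forall i z, z \in L i) ->
  (forall i : 'I_(2 * k).+1, e i <= pair_sum (@sedge (H i)) (L i)) ->
  ohead (L s) = Some x -> last y (L t) = y ->
  (forall j, odd j -> e j = 0) ->
  \sum_(i < k.+1) e (2 * i) + ~~ odd s + ~~ odd t = n + 1 ->
  3 <= 2 * e 0 + (s == 0 :> nat) + (t == 0 :> nat) + ~~ odd s + ~~ odd t ->
  3 <= 2 * e (2 * k) + (s == 2 * k :> nat) + (t == 2 * k :> nat)
         + ~~ odd s + ~~ odd t ->
  exists2 p, @ham_path V (vtx x) p & last (vtx x) p = vtx y.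
Proof.
move=> uL fL eL hx ly e_odd e_sum e_first e_last.
have szL i : size (L i) = n.
  by rewrite -(card_H i) -(card_uniqP (uL i)); apply: eq_card => z; rewrite fL.
pose good i (Q : seq (seq (H i))) :=
  [/\ flatten Q = L i, size Q + e i = n
    & all (fun q => if q is z :: p then path (@sedge (H i)) z p else false) Q].
have [Q QP] : exists Q, forall i, good i (Q i).
  apply: fin_all_exists => i; rewrite /good -(szL i).
  by apply: cut_into_paths; rewrite ?szL.
have [w [pw lw cw]] :=
  layer_walk k_gt0 (ltn_ord s) (ltn_ord t) e_odd e_sum e_first e_last.
pose P j : seq (seq V) :=
  if j <= 2 * k then [seq [seq vtx z | z <- q] | q <- Q (inord j)] else [::].
have PE (i : 'I_(2 * k).+1) : P i = [seq [seq vtx z | z <- q] | q <- Q i].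
  by rewrite /P -ltnS ltn_ord inord_val.
have szP j : size (P j) = count_mem j (nat_of_ord s :: w).
  rewrite cw /P; case: ifP => // jk; rewrite size_map.
  by have [_ sz _] := QP (inord j); rewrite inordK // in sz; lia.
have r_lay (u v : V) : adjn (tag u) (tag v) -> sedge u v.
  by move=> uv; rewrite /= /lex_rel [sedge _ _]uv.
have allP j : all (piece (@sedge V) (fun u : V => tag u : nat) j) (P j).
  rewrite /P; case: ifP => // jk; have [_ _ aQ] := QP (inord j).
  rewrite all_map; apply: sub_all aQ => -[|z q] //= pq.
  rewrite path_map inordK // eqxx /=; apply/andP; split; last first.
    by rewrite all_map; apply/allP => u _ /=; rewrite inordK.
  by move: pq; apply: sub_path => a b; rewrite -(@lex_vertex_adj (path_graph (2 * k).+1) H).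
have [[p v] /= pv [hv lv cv]] := thread_pieces r_lay pw szP allP.
have nQ i : all (fun q => ~~ nilp q) (Q i).
  by have [_ _ aQ] := QP i; apply: sub_all aQ => -[].
have vE : v = vtx x.
  move: hv hx (nQ s); rewrite PE; have [<- _ _] := QP s.
  by case: (Q s) => // -[|a q] Q' //= [<-] [<-].
have lE : last v p = vtx y.
  rewrite -(lv (vtx y)) lw PE -[in RHS]ly; have [<- _ _] := QP t.
  rewrite last_flatten // -[[::]]/(map (@lex_vertex (path_graph (2 * k).+1) H t) [::]).
  by rewrite [X in last _ X]last_map last_map.
have cv1 z : count_mem z (v :: p) = 1.
  rewrite /= cv; case: z => i a /=; rewrite PE -map_flatten; have [-> _ _] := QP i.
  by rewrite count_Tagged count_uniq_mem // fL.
have fv z : z \in v :: p by rewrite -has_pred1 has_count cv1.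
exists p; last by rewrite -vE.
rewrite -vE; split=> //; apply: count_mem_uniq => z; by rewrite cv1 fv.
Qed.
End LexPath.

(** * Counting the edges of a hamiltonian path *)

Lemma pair_sum_lt_size (T : Type) (r : rel T) (s : seq T) :
  0 < size s -> pair_sum r s < size s.
Proof.
elim: s => // x [|y s] IH _; first by [].
have := IH isT; rewrite -[pair_sum r (x :: _)]/(r x y + pair_sum r (y :: s)) /=.
by case: (r x y) => /=; lia.
Qed.

Lemma linear_forest_number_lt (G : sgraph) : 0 < #|G| -> linear_forest_number G < #|G|.
Proof.
have [L [uL fL leL]] := linear_forest_number_enumeration G.
have <- : size L = #|G|.
  by rewrite -(card_uniqP uL); apply: eq_card => z; rewrite fL.
by move=> L_gt0; apply: leq_ltn_trans leL (pair_sum_lt_size _ L_gt0).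
Qed.

Lemma pair_sum_boundary (T : eqType) (b : pred T) (x : T) (p : seq T) u v :
  u \in x :: p -> v \in x :: p -> b u != b v ->
  0 < pair_sum (fun y z => b y (+) b z) (x :: p).
Proof.
move=> ux vx; apply: contraR; rewrite -leqNgt leqn0 => /eqP E.
suff h z : z \in x :: p -> b z = b x by rewrite !h.
elim: p x E {u v ux vx} => [|y p IH] x; first by move=> _; rewrite inE => /eqP->.
rewrite -[pair_sum _ _]/(b x (+) b y + pair_sum (fun y z => b y (+) b z) (y :: p)).
move/eqP; rewrite addn_eq0 => /andP[exy /eqP /IH h].
have -> : b x = b y by case: (b x) (b y) exy => [] [].
by rewrite inE => /orP[/eqP->|/h//]; case: (b x) (b y) exy => [] [].
Qed.

Section LexCount.
Variables (k n : nat) (H : 'I_(2 * k).+1 -> sgraph).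
Hypothesis card_H : forall i, #|H i| = n.

Local Notation V := (@lex_product (path_graph (2 * k).+1) H).
Local Notation vtx := (@lex_vertex (path_graph (2 * k).+1) H _).

Lemma lex_adj_layers (u v : V) :
  sedge u v -> adjn (tag u) (tag v) \/ tag u = tag v.
Proof. by case/orP=> [|/andP[/eqP]]; [left | right]. Qed.

Lemma vtx_tag (u : V) i : tag u = i -> exists a : H i, u = vtx a.
Proof. by move=> <-; exists (tagged u); case: u. Qed.

(** Through [pmap], this partial inverse of [vtx] restricts a path of the product to the layer
    [i]. *)
Definition layer_part i (u : V) : option (H i) := [pick a | vtx a == u].

Lemma layer_part_vtx i (a : H i) : layer_part i (vtx a) = Some a.
Proof.
by rewrite /layer_part; case: pickP => [b /eqP/lex_vertex_inj->//|/(_ a)]; rewrite eqxx.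
Qed.

Lemma layer_part_ocancel i : ocancel (layer_part i) vtx.
Proof. by move=> u; rewrite /layer_part; case: pickP => //= a /eqP. Qed.

(** Deleting the other layers keeps consecutive vertices of the layer [i] consecutive, and can only
    create new pairs. *)
Lemma layer_pair_sum i (x : V) p : path (@sedge V) x p ->
  pair_sum (fun u v : V => (tag u == i) && (tag v == i)) (x :: p) <=
  pair_sum (@sedge (H i)) (pmap (layer_part i) (x :: p)).
Proof.
elim: p x => [|y p IH] x //.
rewrite -[path _ x _]/(sedge x y && path _ y p) => /andP[exy /IH {IH} le].
set s := pmap _ (y :: p) in le *.
rewrite -[pair_sum _ (x :: _)]/((tag x == i) && (tag y == i) + pair_sum _ (y :: p)).
have -> : pmap (layer_part i) (x :: y :: p) = oapp (cons^~ s) s (layer_part i x) by [].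
have skip : pair_sum (@sedge (H i)) s <=
    pair_sum (@sedge (H i)) (oapp (cons^~ s) s (layer_part i x)).
  by case: (layer_part i x) => //= a; apply: leq_addl.
case: eqP => [/vtx_tag[a xa]|_]; last exact: leq_trans le skip.
case: eqP => [/vtx_tag[b yb]|_]; last exact: leq_trans le skip.
move: exy le {skip}; rewrite {}/s {}xa {}yb lex_vertex_adj layer_part_vtx /=.
by rewrite layer_part_vtx /= => -> le; rewrite leq_add2l.
Qed.

Section HamPath.
Variables (x : V) (p : seq V).
Hypothesis ham : ham_path x p.

Let xp_path : path (@sedge V) x p. Proof. by case: ham. Qed.
Let xp_uniq : uniq (x :: p). Proof. by case: ham. Qed.
Let xp_full z : z \in x :: p. Proof. by case: ham. Qed.

Lemma layer_edges_le i :
  pair_sum (fun u v : V => (tag u == i) && (tag v == i)) (x :: p) <=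
  linear_forest_number (H i).
Proof.
apply: leq_trans (layer_pair_sum i xp_path) _.
apply: pair_sum_le_linear_forest_number.
  exact: pmap_uniq (@layer_part_ocancel i) _ xp_uniq.
move=> a; rewrite mem_pmap; apply/mapP; exists (vtx a); first exact: xp_full.
by rewrite layer_part_vtx.
Qed.

Lemma count_layers (P : pred 'I_(2 * k).+1) :
  count (fun u : V => P (tag u)) (x :: p) = \sum_(i | P i) n.
Proof.
rewrite -sum1_count -big_filter.
transitivity (\sum_(u : V | P (tag u)) 1).
  rewrite big_filter [RHS](perm_big (x :: p)) //.
  rewrite uniq_perm ?index_enum_uniq // => u; by rewrite xp_full mem_index_enum.
transitivity (\sum_(i | P i) \sum_(a : H i) 1).
  by rewrite sig_big_dep; apply: eq_bigl => u; rewrite andbT.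
by apply: eq_bigr => i _; rewrite sum1_card card_H.
Qed.

Lemma count_layer i : count (fun u : V => tag u == i) (x :: p) = n.
Proof. by rewrite (count_layers (pred1 i)) big_pred1_eq. Qed.

Lemma size_ham : (size p).+1 = (2 * k).+1 * n.
Proof.
have := count_layers predT; rewrite count_predT sum_nat_const cardT /= => ->.
by rewrite size_enum_ord.
Qed.

Lemma count_odd_layers : count (fun u : V => odd (tag u)) (x :: p) = k * n.
Proof.
rewrite (count_layers (fun i => odd i)) big_mkcond /=.
elim: k => [|k' IH]; first by rewrite big_ord_recr big_ord0.
by rewrite mulnS 2!big_ord_recr /= IH mul2n /= odd_double /= addn0 mulSn addnC.
Qed.

(* Every edge either meets an odd-indexed layer, or lies in one copy of an   *)
(* even-indexed [H i].                                                       *)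
Lemma ham_path_sum_bound :
  n + odd (tag x) + odd (tag (last x p)) <=
  \sum_(i < k.+1) linear_forest_number (H (inord (2 * i))) + 1.
Proof.
have edge (u v : V) : sedge u v -> 1 <= (odd (tag u) + odd (tag v)) +
    \sum_(i < k.+1) ((tag u == inord (2 * i)) && (tag v == inord (2 * i))).
  case ou: (odd (tag u)) => //; case ov: (odd (tag v)) => // /lex_adj_layers[|E].
    rewrite /adjn => /orP[]/eqP/(congr1 odd) /=; by rewrite ou ov.
  have lt : (tag u)./2 < k.+1 by have := ltn_ord (tag u); lia.
  rewrite (bigD1 (Ordinal lt)) //= -E.
  have -> : 2 * (tag u)./2 = tag u by rewrite mul2n; have := odd_double_half (tag u); rewrite ou.
  by rewrite inord_val eqxx.
have := pair_sum_le edge xp_path; rewrite pair_sum1 pair_sumD pair_sum_bigsum.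
have := pair_sum_ends (fun u : V => odd (tag u)) x p; rewrite count_odd_layers.
have : \sum_(i < k.+1) pair_sum (fun u v : V =>
     (tag u == inord (2 * i)) && (tag v == inord (2 * i))) (x :: p) <=
    \sum_(i < k.+1) linear_forest_number (H (inord (2 * i))).
  by apply: leq_sum => i _; apply: layer_edges_le.
(* The path has [2 * k * n + n - 1] edges, while the degrees in the odd layers sum to [2 * k * n]
   less the ends there. *)
have : (size p).+1 = n + (k * n).*2 by rewrite size_ham mulSn -mulnA mul2n.
move: (\sum_(i < _) _) (\sum_(i < _) _) (pair_sum _ _) => S1 S2 S3.
by move: (odd _) (odd _) (size p) (k * n) => a b sz kn; lia.
Qed.

(** The degrees in [c0] come from inner edges, counted twice, and from edges to [c1]. The degrees in
    [c1] must cover the latter and at least one edge leaving both layers, since the path reaches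
    [z]. Each layer has degree sum [2 * n] less its ends. *)
Lemma ham_path_end_bound (c0 c1 c2 : 'I_(2 * k).+1) (z : H c2) :
  c2 != c0 -> c2 != c1 -> c0 != c1 ->
  (forall i : 'I_(2 * k).+1, adjn c0 i -> i = c1) ->
  1 + (tag x == c1) + (tag (last x p) == c1) <=
  2 * linear_forest_number (H c0) + (tag x == c0) + (tag (last x p) == c0).
Proof.
move=> n20 n21 n01 nbr.
pose b (u : V) := (tag u == c0) || (tag u == c1).
have edge (u v : V) : sedge u v ->
    (tag u == c0) + (tag v == c0) + (b u (+) b v) <=
    ((tag u == c0) && (tag v == c0) + (tag u == c0) && (tag v == c0))
      + ((tag u == c1) + (tag v == c1)).
  rewrite /b; case/lex_adj_layers => [adj|->]; last by do 2!case: (tag v == _).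
  have := nbr (tag u); have := nbr (tag v); move: adj.
  case: (eqVneq (tag u) c0) => [->|nu]; case: (eqVneq (tag v) c0) => [->|nv].
  - by rewrite (negbTE n01).
  - by move=> adj /(_ adj) -> _; rewrite (negbTE n01) eqxx.
  - rewrite /adjn orbC => adj _ /(_ adj) ->; by rewrite (negbTE n01) eqxx.
  - by case: (tag u == c1); case: (tag v == c1).
have [u xu bu] : exists2 u, u \in x :: p & b u.
  have n_gt0 : 0 < n by rewrite -(card_H c2); apply/card_gt0P; exists z.
  have /card_gt0P[a _] : 0 < #|H c0| by rewrite card_H.
  by exists (vtx a); rewrite ?xp_full // /b eqxx.
have bz : b u != b (vtx z) by rewrite bu /b /= (negbTE n20) (negbTE n21).
have := pair_sum_boundary xu (xp_full (vtx z)) bz.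
have := pair_sum_le edge xp_path.
rewrite !(pair_sumD, pair_sumD (fun u v : V => _ && _ + _)).
have := pair_sum_ends (fun u : V => tag u == c0) x p.
have := pair_sum_ends (fun u : V => tag u == c1) x p.
rewrite !count_layer !pair_sumD; have := layer_edges_le c0.
do 6!move: (pair_sum _ _) => ?; do 4!move: (nat_of_bool _) => ?.
by move: (linear_forest_number _) => ?; lia.
Qed.
End HamPath.
End LexCount.

(** * Sufficiency *)

Lemma sum_between k (l u : nat -> nat) T :
  (forall i, i < k -> l i <= u i) ->
  \sum_(i < k) l i <= T -> T <= \sum_(i < k) u i ->
  exists2 e : nat -> nat, forall i, i < k -> l i <= e i <= u i
    & \sum_(i < k) e i = T.
Proof.
elim: k T => [|k IH] T lu.
  by rewrite !big_ord0 => _ T0; exists l; rewrite // big_ord0; lia.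
rewrite !big_ord_recr /= => lT Tu.
have lu_sum : \sum_(i < k) l i <= \sum_(i < k) u i.
  by apply: leq_sum => i _; apply/lu/ltnW/(ltn_ord i).
have lk := lu k (ltnSn k).
(* The last term is as small as allowed: its own minimum, or what the other terms cannot supply. *)
pose ek := maxn (l k) (T - \sum_(i < k) u i).
have [i ik|||e eP eT] := IH (T - ek); first exact/lu/ltnW.
- by move: lT Tu lu_sum lk; rewrite /ek; do 2!move: (\sum_(i < k) _) => ?; clear; lia.
- by move: lT Tu lu_sum lk; rewrite /ek; do 2!move: (\sum_(i < k) _) => ?; clear; lia.
exists (fun i => if i == k then ek else e i) => [i|].
  case: (eqVneq i k) => [->|nik] ik; first last.
    by apply: eP; rewrite ltn_neqAle nik -ltnS.
  by move: lT Tu lu_sum lk; rewrite /ek; do 2!move: (\sum_(i < k) _) => ?; clear; lia.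
rewrite big_ord_recr /= eqxx (eq_bigr (fun i : 'I_k => e i)).
  rewrite eT; move: lT Tu lu_sum lk; rewrite /ek.
  by do 2!move: (\sum_(i < k) _) => ?; clear; lia.
by move=> i _; rewrite ltn_eqF.
Qed.

Section LexSufficient.
Variables (k n : nat) (H : 'I_(2 * k).+1 -> sgraph).
Hypotheses (k_gt0 : 0 < k) (n_gt0 : 0 < n).
Hypothesis card_H : forall i, #|H i| = n.

Local Notation V := (@lex_product (path_graph (2 * k).+1) H).
Local Notation vtx := (@lex_vertex (path_graph (2 * k).+1) H _).

(** [lex_ham_path] asks for an exact total; [sum_between] finds it between the minima [m0], [mk] on
    the extreme layers and the edges available in the listings. *)
Lemma lex_ham_path_exists (s t : 'I_(2 * k).+1) (L : forall i, seq (H i))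
    (m0 mk : nat) (x : H s) (y : H t) :
  (forall i, uniq (L i)) -> (forall i z, z \in L i) ->
  ohead (L s) = Some x -> last y (L t) = y ->
  m0 <= pair_sum (@sedge (H ord0)) (L ord0) ->
  mk <= pair_sum (@sedge (H ord_max)) (L ord_max) ->
  m0 + mk + ~~ odd s + ~~ odd t <= n + 1 ->
  n + 1 <= \sum_(i < k.+1) pair_sum (@sedge _) (L (inord (2 * i)))
            + ~~ odd s + ~~ odd t ->
  3 <= 2 * m0 + (s == 0 :> nat) + (t == 0 :> nat) + ~~ odd s + ~~ odd t ->
  3 <= 2 * mk + (s == 2 * k :> nat) + (t == 2 * k :> nat)
         + ~~ odd s + ~~ odd t ->
  exists2 p, @ham_path V (vtx x) p & last (vtx x) p = vtx y.
Proof.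
move=> uL fL hx ly le0 lek le_n ge_n first_ last_.
pose u i := pair_sum (@sedge _) (L (inord (2 * i))).
pose l i := (if i == 0 then m0 else 0) + (if i == k then mk else 0).
have u0 : u 0 = pair_sum (@sedge (H ord0)) (L ord0).
  by rewrite /u muln0 (_ : inord 0 = ord0) //; apply/val_inj; rewrite /= inordK.
have uk : u k = pair_sum (@sedge (H ord_max)) (L ord_max).
  by rewrite /u (_ : inord (2 * k) = ord_max) //; apply/val_inj; rewrite /= inordK.
have suml : \sum_(i < k.+1) l i = m0 + mk.
  rewrite big_split /=; congr (_ + _).
    by rewrite big_ord_recl /= big1 ?addn0.
  rewrite big_ord_recr /= eqxx big1 // => i _; by rewrite ltn_eqF.
have ends_le : ~~ odd s + ~~ odd t <= n + 1.
  by apply: leq_trans le_n; rewrite -addnA leq_addl.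
have [i ik|||e eP eT] := @sum_between k.+1 l u (n + 1 - ~~ odd s - ~~ odd t).
- rewrite /l; case: eqVneq => [->|ni]; first by rewrite eq_sym gtn_eqF // addn0 u0.
  by case: eqVneq => [->|//]; rewrite uk.
- by rewrite suml -subnDA leq_subRL // addnC addnA.
- by rewrite -subnDA leq_subLR; apply: leq_trans ge_n _; rewrite -addnA addnC.
pose e' j := if odd j then 0 else e j./2.
have e'E i : e' (2 * i) = e i by rewrite /e' mul2n odd_double doubleK.
apply: (@lex_ham_path k n H k_gt0 n_gt0 card_H s t L e' x y) => //.
- move=> i; rewrite /e'; case oi: (odd i) => //.
  have hi : i./2 < k.+1 by rewrite ltnS leq_half_double -mul2n; apply: leqW; rewrite -ltnS.
  have /andP[_] := eP _ hi; rewrite /u.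
  have -> : 2 * i./2 = i by rewrite mul2n; have := odd_double_half i; rewrite oi.
  by rewrite inord_val.
- by move=> j oj; rewrite /e' oj.
- under eq_bigr do rewrite e'E.
  by rewrite eT -subnDA -addnA subnK.
- have /andP[le_e _] := eP 0 isT; apply: leq_trans first_ _.
  rewrite !leq_add2r leq_pmul2l // (e'E 0 : e' 0 = e 0).
  by apply: leq_trans le_e; rewrite /l eqxx leq_addr.
- have /andP[le_e _] := eP k (ltnSn k); apply: leq_trans last_ _.
  rewrite !leq_add2r leq_pmul2l // e'E.
  by apply: leq_trans le_e; rewrite /l eqxx leq_addl.
Qed.

Lemma enumerations : exists L : forall i, seq (H i), forall i,
  [/\ uniq (L i), forall z, z \in L i
    & linear_forest_number (H i) <= pair_sum (@sedge (H i)) (L i)].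
Proof.
apply: (@fin_all_exists _ (fun i => seq (H i)) (fun i (L : seq (H i)) =>
  [/\ uniq L, forall z, z \in L
    & linear_forest_number (H i) <= pair_sum (@sedge (H i)) L])) => i.
exact: linear_forest_number_enumeration.
Qed.

(** A path from the first layer to the last: two even ends lower the total to [n - 1], and ends in
    both extreme layers allow the minima to be 0. *)
Lemma traceable_of_sum :
  n - 1 <= \sum_(i < k.+1) linear_forest_number (H (inord (2 * i))) ->
  traceable V.
Proof.
move=> le_n; have [L LP] := enumerations.
have odd2k : odd (2 * k) = false by rewrite mul2n odd_double.
have /card_gt0P[a _] : 0 < #|H ord0| by rewrite card_H.
have /card_gt0P[b _] : 0 < #|H ord_max| by rewrite card_H.
have [_ fa _] := LP ord0; have [_ fb _] := LP ord_max.
have [x hx] : exists x, ohead (L ord0) = Some x.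
  by case: (L ord0) (fa a) => // x s _; exists x.
have [||||||||||p hp _] := @lex_ham_path_exists ord0 ord_max L 0 0 x (last b (L ord_max)).
- by move=> i; have [] := LP i.
- by move=> i; have [] := LP i.
- by [].
- by case: (L ord_max) (fb b).
- by [].
- by [].
- by rewrite /= odd2k; lia.
- have : \sum_(i < k.+1) linear_forest_number (H (inord (2 * i))) <=
     \sum_(i < k.+1) pair_sum (@sedge _) (L (inord (2 * i))).
    by apply: leq_sum => i _; have [] := LP (inord (2 * i)).
  by rewrite /= odd2k; move: le_n; do 2!move: (\sum_(i < k.+1) _) => ?; lia.
- by rewrite /= odd2k; lia.
- by rewrite /= odd2k; lia.
by exists (vtx x), p.
Qed.

Lemma hamiltonian_of_sum :
  1 <= linear_forest_number (H ord0) ->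
  1 <= linear_forest_number (H ord_max) ->
  n <= \sum_(i < k.+1) linear_forest_number (H (inord (2 * i))) ->
  hamiltonian V.
Proof.
move=> pi0 pik le_n; have [L LP] := enumerations.
pose c1 : 'I_(2 * k).+1 := inord 1.
pose c2 : 'I_(2 * k).+1 := inord 2.
have c1E : c1 = 1 :> nat by rewrite inordK //; lia.
have c2E : c2 = 2 :> nat by rewrite inordK //; lia.
have /card_gt0P[a _] : 0 < #|H ord0| by rewrite card_H.
have /card_gt0P[b _] : 0 < #|H c1| by rewrite card_H.
have /card_gt0P[c _] : 0 < #|H c2| by rewrite card_H.
have [_ fa le0] := LP ord0; have [_ fb _] := LP c1; have [_ _ lek] := LP ord_max.
have n_ge2 : 1 < n.
  by rewrite -(card_H ord0) (leq_ltn_trans pi0) // linear_forest_number_lt // card_H.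
have [x hx] : exists x, ohead (L ord0) = Some x.
  by case: (L ord0) (fa a) => // x s _; exists x.
(* Ending in [c1], next to the first layer, closes the cycle. One odd end makes the total [n] and
   the minima 1; [n_ge2] leaves room for both minima. *)
have [||||||||||p [pp pu pf] lp] := @lex_ham_path_exists ord0 c1 L 1 1 x (last b (L c1)).
- by move=> i; have [] := LP i.
- by move=> i; have [] := LP i.
- by [].
- by case: (L c1) (fb b).
- exact: leq_trans pi0 le0.
- exact: leq_trans pik lek.
- by rewrite c1E /=; lia.
- have : \sum_(i < k.+1) linear_forest_number (H (inord (2 * i))) <=
     \sum_(i < k.+1) pair_sum (@sedge _) (L (inord (2 * i))).
    by apply: leq_sum => i _; have [] := LP (inord (2 * i)).
  by rewrite c1E /=; move: le_n; do 2!move: (\sum_(i < k.+1) _) => ?; lia.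
- by rewrite c1E.
- by rewrite c1E /=; lia.
exists (vtx x :: p); split=> //.
- have sub : {subset [:: vtx a; vtx b; vtx c] <= vtx x :: p} by move=> z _; apply: pf.
  apply: (uniq_leq_size _ sub); rewrite /= !inE.
  have neq i j (d : H i) (d' : H j) : i != j :> nat -> (vtx d == vtx d') = false.
    by move=> nij; apply/negbTE; apply: contra nij => /eqP/(congr1 (fun z : V => tag z))/= ->.
  by rewrite !neq //= ?c1E ?c2E.
- rewrite /ucycle pu andbT /= rcons_path pp lp /= /lex_rel /= c1E.
  by [].
Qed.

(** Bringing each prescribed vertex to its place breaks at most one pair, hence the two indicator
    terms. *)
Lemma arranged_enumerations (X Y : V) : X != Y ->
  exists L : forall i, seq (H i), forall i,
    [/\ uniq (L i), forall z, z \in L i,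
        linear_forest_number (H i) <=
          pair_sum (@sedge (H i)) (L i) + (tag X == i) + (tag Y == i),
        forall x : H i, vtx x = X -> ohead (L i) = Some x
      & forall y : H i, vtx y = Y -> last y (L i) = y].
Proof.
move=> nXY.
apply: (@fin_all_exists _ (fun i => seq (H i)) (fun i (L : seq (H i)) =>
  [/\ uniq L, forall z, z \in L,
        linear_forest_number (H i) <=
          pair_sum (@sedge (H i)) L + (tag X == i) + (tag Y == i),
        forall x : H i, vtx x = X -> ohead L = Some x
      & forall y : H i, vtx y = Y -> last y L = y])) => i.
have [L [uL fL le]] := linear_forest_number_enumeration (H i).
have sym := @sedge_sym (H i).
have fin s' : perm_eq s' L -> uniq s' /\ (forall z, z \in s').
  by move=> ps; rewrite (perm_uniq ps); split=> // z; rewrite (perm_mem ps).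
have no (Z : V) : tag Z != i -> forall z : H i, vtx z = Z -> False.
  by move=> nZ z E; rewrite -E eqxx in nZ.
have [eX|nX] := eqVneq (tag X) i; have [eY|nY] := eqVneq (tag Y) i.
- have [x Xx] := vtx_tag eX; have [y Yy] := vtx_tag eY.
  have nxy : x != y by apply: contraNneq nXY => E; rewrite Xx Yy E.
  have [s' [/fin[us fs] les]] := rearrange_both sym (fL x) (fL y) nxy.
  exists (x :: rcons s' y); split=> //; first by rewrite -addnA addn2 (leq_trans le).
    by move=> z; rewrite Xx => /lex_vertex_inj->.
  by move=> z; rewrite Yy => /lex_vertex_inj->; rewrite /= last_rcons.
- have [x Xx] := vtx_tag eX.
  have [s' [/fin[us fs] les]] := rearrange_head (@sedge (H i)) (fL x).
  exists (x :: s'); split=> //; first by rewrite addn0 addn1 (leq_trans le).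
    by move=> z; rewrite Xx => /lex_vertex_inj->.
  by move=> z /(no _ nY).
- have [y Yy] := vtx_tag eY.
  have [s' [/fin[us fs] les]] := rearrange_last sym (fL y).
  exists (rcons s' y); split=> //; first by rewrite addn0 addn1 (leq_trans le).
    by move=> z /(no _ nX).
  by move=> z; rewrite Yy => /lex_vertex_inj->; rewrite last_rcons.
- exists L; split=> //; first by rewrite !addn0.
    by move=> z /(no _ nX).
  by move=> z /(no _ nY).
Qed.

Lemma sum_layer_is_even (s : 'I_(2 * k).+1) :
  \sum_(i < k.+1) (s == inord (2 * i)) = ~~ odd s.
Proof.
have -> : ~~ odd s = ~~ odd s && (s < 2 * k.+1) by have := ltn_ord s; case: odd => /=; lia.
rewrite -sum_eq_even; apply: eq_bigr => i _; congr nat_of_bool.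
by rewrite -val_eqE /= inordK //; have := ltn_ord i; lia.
Qed.

(** An end in an even layer may cost one edge of its listing but also lowers the required total by
    one, so [n + 1] suffices wherever the ends lie. *)
Lemma hamiltonian_connected_of_sum :
  2 <= linear_forest_number (H ord0) ->
  2 <= linear_forest_number (H ord_max) ->
  n + 1 <= \sum_(i < k.+1) linear_forest_number (H (inord (2 * i))) ->
  hamiltonian_connected V.
Proof.
move=> pi0 pik le_n X Y nXY; have [L LP] := arranged_enumerations nXY.
have n_ge3 : 2 < n.
  by rewrite -(card_H ord0) (leq_ltn_trans pi0) // linear_forest_number_lt // card_H.
pose s := tag X; pose t := tag Y.
have [x Xx] := vtx_tag (erefl s); have [y Yy] := vtx_tag (erefl t).
have [_ _ le0 _ _] := LP ord0; have [_ _ lek _ _] := LP ord_max.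
have eq0 (u : 'I_(2 * k).+1) : (u == ord0) = (u == 0 :> nat) by [].
have eqk (u : 'I_(2 * k).+1) : (u == ord_max) = (u == 2 * k :> nat) by [].
rewrite !eq0 in le0; rewrite !eqk in lek.
have ev0 (u : 'I_(2 * k).+1) : (u == 0 :> nat) <= ~~ odd u.
  by case: eqP => // ->.
have evk (u : 'I_(2 * k).+1) : (u == 2 * k :> nat) <= ~~ odd u.
  by case: eqP => // ->; rewrite mul2n odd_double.
(* [d] is the number of ends in an extreme layer. That layer must keep 2 edges if both ends are odd,
   none if it contains both ends, and 1 otherwise; the rearranged listing still has them. *)
pose m (d : nat) := if odd s && odd t then 2 else (d < 2 : nat).
rewrite Xx Yy; apply: (@lex_ham_path_exists s t L
  (m ((s == 0 :> nat) + (t == 0 :> nat)))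
  (m ((s == 2 * k :> nat) + (t == 2 * k :> nat)))).
- by move=> i; have [] := LP i.
- by move=> i; have [] := LP i.
- by have [_ _ _ h _] := LP s; apply: h.
- by have [_ _ _ _ h] := LP t; apply: h.
- move: (ev0 s) (ev0 t) le0; rewrite /m -/s -/t.
  move: (pair_sum _ _) (linear_forest_number _) pi0 => P q q2.
  by case: (odd s); case: (odd t); case: (s == 0 :> nat); case: (t == 0 :> nat) => //=; lia.
- move: (evk s) (evk t) lek; rewrite /m -/s -/t.
  move: (pair_sum _ _) (linear_forest_number _) pik => P q q2.
  by case: (odd s); case: (odd t); case: (s == 2 * k :> nat);
    case: (t == 2 * k :> nat) => //=; lia.
- rewrite /m; move: (_ < 2) (_ < 2) => b1 b2; move: n_ge3; clear.
  by case: (odd s); case: (odd t); case: b1; case: b2 => /=; lia.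
- rewrite -!sum_layer_is_even -!big_split /=; apply: leq_trans le_n _.
  by apply: leq_sum => i _; have [] := LP (inord (2 * i)).
- move: (ev0 s) (ev0 t); rewrite /m.
  by case: (odd s); case: (odd t); case: (s == 0 :> nat); case: (t == 0 :> nat).
- move: (evk s) (evk t); rewrite /m.
  by case: (odd s); case: (odd t); case: (s == 2 * k :> nat); case: (t == 2 * k :> nat).
Qed.
End LexSufficient.

(** * Necessity *)

Lemma hamiltonian_ham_path (G : sgraph) (z : G) :
  hamiltonian G -> exists p, ham_path z p.
Proof.
case=> c [_ /andP[cc cu] fc]; have [i p E] := rot_to (fc z).
exists p; split.
- have : cycle (@sedge G) (z :: p) by rewrite -E rot_cycle.
  by rewrite /= rcons_path => /andP[].
- by rewrite -E rot_uniq.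
- by move=> u; rewrite -E mem_rot.
Qed.

Section LexNecessary.
Variables (k n : nat) (H : 'I_(2 * k).+1 -> sgraph).
Hypotheses (k_gt0 : 0 < k) (n_gt0 : 0 < n).
Hypothesis card_H : forall i, #|H i| = n.

Local Notation V := (@lex_product (path_graph (2 * k).+1) H).
Local Notation vtx := (@lex_vertex (path_graph (2 * k).+1) H _).

Let c1 : 'I_(2 * k).+1 := inord 1.
Let cp : 'I_(2 * k).+1 := inord (2 * k).-1.

Let c1E : c1 = 1 :> nat. Proof. by rewrite inordK //; lia. Qed.
Let cpE : cp = (2 * k).-1 :> nat. Proof. by rewrite inordK //; lia. Qed.

Let c1_neq0 : (c1 == ord0) = false. Proof. by rewrite -val_eqE /= c1E. Qed.
Let cp_neq_max : (cp == ord_max) = false.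
Proof. by rewrite -val_eqE /= cpE; lia. Qed.

Let witness i : exists a : H i, true.
Proof. by have /card_gt0P[a _] : 0 < #|H i|; [rewrite card_H | exists a]. Qed.

Let first_bound (x : V) p : ham_path x p ->
  1 + (tag x == c1) + (tag (last x p) == c1) <=
  2 * linear_forest_number (H ord0) + (tag x == ord0) + (tag (last x p) == ord0).
Proof.
move=> hp; have [z _] := witness ord_max.
apply: (ham_path_end_bound card_H hp z); rewrite -?val_eqE /= ?c1E; try lia.
by move=> i; rewrite /adjn => adj; apply/val_inj; rewrite /= c1E; move: adj => /=; lia.
Qed.

Let last_bound (x : V) p : ham_path x p ->
  1 + (tag x == cp) + (tag (last x p) == cp) <=
  2 * linear_forest_number (H ord_max)
    + (tag x == ord_max) + (tag (last x p) == ord_max).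
Proof.
move=> hp; have [z _] := witness ord0.
apply: (ham_path_end_bound card_H hp z); rewrite -?val_eqE /= ?cpE; try lia.
move=> i; rewrite /adjn => adj; apply/val_inj; rewrite /= cpE.
by move: adj (ltn_ord i) => /=; lia.
Qed.

(** The cycle is opened at a vertex next to the first layer, then next to the last: an end there
    raises both the end bound and the sum bound. *)
Lemma hamiltonian_bounds : hamiltonian V ->
  [/\ 1 <= linear_forest_number (H ord0), 1 <= linear_forest_number (H ord_max)
    & n <= \sum_(i < k.+1) linear_forest_number (H (inord (2 * i)))].
Proof.
move=> hamV; have [a _] := witness c1; have [b _] := witness cp.
have [p hp] := hamiltonian_ham_path (vtx a) hamV.
have [q hq] := hamiltonian_ham_path (vtx b) hamV.
split.
- have := first_bound hp; rewrite /= eqxx c1_neq0.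
  by case: (_ == c1); case: (_ == ord0); lia.
- have := last_bound hq; rewrite /= eqxx cp_neq_max.
  by case: (_ == cp); case: (_ == ord_max); lia.
- by have := ham_path_sum_bound card_H hp; rewrite /= c1E /=; lia.
Qed.

Lemma traceable_bound : traceable V ->
  n - 1 <= \sum_(i < k.+1) linear_forest_number (H (inord (2 * i))).
Proof. by case=> x [p hp]; have := ham_path_sum_bound card_H hp; lia. Qed.

(** Taking both ends in [c1], then in [cp], makes the bounds strongest. *)
Lemma hamiltonian_connected_bounds : hamiltonian_connected V ->
  [/\ 2 <= linear_forest_number (H ord0), 2 <= linear_forest_number (H ord_max)
    & n + 1 <= \sum_(i < k.+1) linear_forest_number (H (inord (2 * i)))].
Proof.
move=> hc.
(* With one vertex per layer no such two ends exist, but all the linear forest numbers are then 0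
   and a path joining the first two layers contradicts the sum bound. *)
have [n_le1|n_gt1] := leqP n 1.
  have n1 : n = 1 by lia.
  have [a _] := witness ord0; have [b _] := witness c1.
  have nab : vtx a != vtx b.
    by apply/eqP => /(congr1 (fun z : V => tag z : nat)) /=; rewrite c1E.
  have [p hp lp] := hc _ _ nab; have := ham_path_sum_bound card_H hp.
  rewrite lp /= c1E big1 ?n1 // => i _; apply/eqP.
  rewrite -leqn0 -ltnS -[X in _ < X]n1 -(card_H (inord (2 * i))).
  by rewrite linear_forest_number_lt ?card_H.
have pair i : exists x p, [/\ @ham_path V x p, tag x = i & tag (last x p) = i].
  have /card_gt1P[a [b [_ _ nab]]] : 1 < #|H i| by rewrite card_H.
  have nab' : vtx a != vtx b by apply: contra nab => /eqP/lex_vertex_inj ->.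
  by have [p hp lp] := hc _ _ nab'; exists (vtx a), p; rewrite lp.
have [x [p [hp xc pc]]] := pair c1; have [y [q [hq yc qc]]] := pair cp.
split.
- by have := first_bound hp; rewrite xc pc eqxx c1_neq0; lia.
- by have := last_bound hq; rewrite yc qc eqxx cp_neq_max; lia.
- by have := ham_path_sum_bound card_H hp; rewrite xc pc c1E /=; lia.
Qed.
End LexNecessary.

Theorem theorem2 (k n : nat) (H : 'I_(2 * k).+1 -> sgraph)
    (k_ge1 : 1 <= k) (n_ge1 : 1 <= n)
    (card_H : forall i : 'I_(2 * k).+1, #|H i| = n) :
  [/\ hamiltonian (@lex_product (path_graph (2 * k).+1) H) <->
        [/\ 1 <= linear_forest_number (H ord0),
            1 <= linear_forest_number (H ord_max)
          & n <= \sum_(i < k.+1) linear_forest_number (H (inord (2 * i)))],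
      traceable (@lex_product (path_graph (2 * k).+1) H) <->
        n - 1 <= \sum_(i < k.+1) linear_forest_number (H (inord (2 * i)))
    & hamiltonian_connected (@lex_product (path_graph (2 * k).+1) H) <->
        [/\ 2 <= linear_forest_number (H ord0),
            2 <= linear_forest_number (H ord_max)
          & n + 1 <= \sum_(i < k.+1) linear_forest_number (H (inord (2 * i)))]].
Proof.
split; split.
- exact: hamiltonian_bounds.
- by case; apply: hamiltonian_of_sum.
- exact: traceable_bound.
- exact: traceable_of_sum.
- exact: hamiltonian_connected_bounds.
- by case; apply: hamiltonian_connected_of_sum.
Qed.
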